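(* Let $\kappa\in(8/3,8)$, $\alpha\in\mathbb R$ and $\mu$ a probability measure on $\mathbb R$. (i) If $\alpha=0$, then $\nu\mapsto\gamma_\kappa(\alpha,\nu)$ has a unique minimizer $\nu_0$ on $[0,\infty)$. (ii) If $\alpha>0$ and $\mu((0,\infty))>0$, or $\alpha<0$ and $\mu((-\infty,0))>0$, then $\nu\mapsto\gamma_\kappa(\alpha,\nu)$ has a unique minimizer $\nu_0$ on $[0,\infty)$, and $\nu_0>0$. (iii) If $\alpha>0$ and $\mu((0,\infty))=0$, or $\alpha<0$ and $\mu((-\infty,0))=0$, then $\gamma_\kappa(\alpha,\nu)=\infty$ for all $\nu\in[0,\infty)$.
   Context: Let $\Lambda_\mu(\lambda)=\log\int e^{\lambda x}\,d\mu(x)$, $\Lambda_\kappa(\lambda)=\log\big(-\cos(4\pi/\kappa)/\cos(\pi\sqrt{(1-4/\kappa)^2+8\lambda/\kappa})\big)$ for $\lambda<1-\frac2\kappa-\frac{3\kappa}{32}$ (with $\cos(\pi\sqrt{\cdot})=\cosh(\pi\sqrt{-\cdot})$ for negative argument) and $+\infty$ otherwise, and $\Lambda^\star(x)=\sup_\lambda(\lambda x-\Lambda(\lambda))$. Define $\gamma_\kappa(\alpha,\nu)=\nu\Lambda_\mu^\star(\alpha/\nu)+\nu\Lambda_\kappa^\star(1/\nu)$ for $\nu>0$; $\gamma_\kappa(\alpha,0)=\lim_{\nu'\downarrow0}\gamma_\kappa(\alpha,\nu')$ for $\alpha\neq0$; $\gamma_\kappa(0,0)=1-\frac2\kappa-\frac{3\kappa}{32}$.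 *)

(* Defs.v *)
From HB Require Import structures.
From mathcomp Require Import all_boot all_order all_algebra.
From mathcomp Require Import all_classical all_reals all_analysis.
Set Implicit Arguments. Unset Strict Implicit. Unset Printing Implicit Defensive.
Import Order.TTheory GRing.Theory Num.Theory.
Import numFieldNormedType.Exports.
Local Open Scope classical_set_scope.
Local Open Scope ring_scope.

Section Defs.
Variable R : realType.

Definition elog (x : \bar R) : \bar R :=
  match x with
  | r%:E => (ln r)%:E
  | +oo%E => +oo%E
  | -oo%E => -oo%E
  end.

Definition Lambda_mu (mu : probability R R) (l : R) : \bar R :=
  elog (\int[mu]_x (expR (l * x))%:E)%E.

Definition cosh_ (x : R) : R := (expR x + expR (- x)) / 2.

Definition cos_pi_sqrt (s : R) : R :=
  if 0 <= s then cos (pi * Num.sqrt s) else cosh_ (pi * Num.sqrt (- s)).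

Definition Lambda_kappa (kappa l : R) : \bar R :=
  if l < 1 - 2 / kappa - 3 * kappa / 32 then
    (ln (- cos (4 * pi / kappa) /
         cos_pi_sqrt ((1 - 4 / kappa) ^+ 2 + 8 * l / kappa)))%:E
  else +oo%E.

Definition legendre (L : R -> \bar R) (x : R) : \bar R :=
  ereal_sup [set ((l * x)%:E - L l)%E | l in [set: R]].

Definition gamma_pos (kappa : R) (mu : probability R R) (alpha nu : R)
  : \bar R :=
  (nu%:E * legendre (Lambda_mu mu) (alpha / nu)
   + nu%:E * legendre (Lambda_kappa kappa) (1 / nu))%E.

(* gamma_kappa(alpha, nu) for nu >= 0 (value for nu < 0 irrelevant: +oo) *)
Definition gamma_k (kappa : R) (mu : probability R R) (alpha nu : R)
  : \bar R :=
  if 0 < nu then gamma_pos kappa mu alpha nu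
  else if nu == 0 then
    (if alpha == 0 then (1 - 2 / kappa - 3 * kappa / 32)%:E
     else lim (gamma_pos kappa mu alpha nu' @[nu' --> 0^'+]))
  else +oo%E.

Definition minimizer_nonneg (f : R -> \bar R) (x : R) : Prop :=
  0 <= x /\ forall y, 0 <= y -> (f x <= f y)%E.

End Defs.

(* Main.v *)
Require Import Defs.
From HB Require Import structures.
From mathcomp Require Import all_boot all_order all_algebra.
From mathcomp Require Import all_classical all_reals all_analysis.
From mathcomp Require Import measurable_realfun.
From mathcomp Require Import ring lra.
Import Order.TTheory GRing.Theory Num.Theory.
Import numFieldNormedType.Exports.
Local Open Scope classical_set_scope.
Local Open Scope ring_scope.

(** For nu > 0, gamma(alpha, nu) is the supremum over (l, l') of the functions
    l alpha + l' - nu (Lambda_mu(l) + Lambda_kappa(l')), affine in nu.  Minimizing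
    over nu is therefore dual to maximizing l alpha + l' subject to
    Lambda_mu(l) + Lambda_kappa(l') <= 0.  In case (ii) the constraint set cut
    by l alpha + l' >= 0 is compact: it is closed because the moment generating
    function is lower semicontinuous, and bounded because that function grows
    exponentially in the direction of alpha while exp(- Lambda_kappa(l')) grows
    like exp(c sqrt(- l')).  At a maximizer (l, l') the number
    nu0 = 1 / Lambda_kappa'(l') attains the dual value, and it is the only one
    that does because Lambda_kappa is convex and differentiable at l'.  By
    convexity gamma is nonincreasing on (0, nu0], so its limit at 0 exists and
    exceeds the minimum.  In case (i), Lambda_mu enters only through
    c = Lambda_mu^*(0) and the same argument applies with l' such that
    Lambda_kappa(l') = c, or gamma is infinite on (0, oo) if c is.  In case
    (iii), Lambda_mu <= 0 on a half-line, so Lambda_mu^*(alpha / nu) is infinite.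
    Negative alpha reduces to positive alpha by reflecting l.

    Convexity of Lambda_kappa means that tan(sqrt z) / sqrt z is nondecreasing
    for z < (pi / 2)^2, read as tanh(sqrt(- z)) / sqrt(- z) for z < 0. *)

Set Implicit Arguments.
Unset Strict Implicit.
Unset Printing Implicit Defensive.

(** * The functions cos (sqrt z) and sin (sqrt z) / sqrt z *)

Section RealFunctions.
Context {R : realType}.
Implicit Types (f df : R -> R) (x y z w p q e b s : R).

Lemma is_derive_MVT f df x y : x <= y ->
  (forall t, t \in `[x, y] -> is_derive t 1 f (df t)) ->
  exists2 c, c \in `[x, y] & f y - f x = df c * (y - x).
Proof.
move=> xy fdf.
have d1 t : t \in `]x, y[ -> is_derive t 1 f (df t).
  by move=> txy; apply: fdf; exact: (subset_itv_oo_cc txy).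
have c : {within `[x, y], continuous f}.
  by apply: derivable_within_continuous => t txy; have [] := fdf t txy.
exact: MVT_segment xy d1 c.
Qed.

(** * Hyperbolic functions and mean-value bounds for sin and sinh *)

Definition sinh_ x : R := (expR x - expR (- x)) / 2.

Lemma is_derive_cosh x : is_derive x 1 (@cosh_ R) (sinh_ x).
Proof.
rewrite /cosh_ /sinh_; apply: is_derive_eq.
by rewrite /GRing.scale /=; ring.
Qed.

Lemma is_derive_sinh x : is_derive x 1 sinh_ (cosh_ x).
Proof.
rewrite /cosh_ /sinh_; apply: is_derive_eq.
by rewrite /GRing.scale /=; ring.
Qed.

Lemma cosh0 : cosh_ (0 : R) = 1.
Proof. by rewrite /cosh_ oppr0 expR0; lra. Qed.

Lemma sinh0 : sinh_ (0 : R) = 0.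
Proof. by rewrite /sinh_ oppr0 subrr mul0r. Qed.

Lemma cosh_gt0 x : 0 < cosh_ x.
Proof. by rewrite /cosh_ divr_gt0 // addr_gt0 ?expR_gt0. Qed.

Lemma sinh_ge0 x : 0 <= x -> 0 <= sinh_ x.
Proof. by move=> x0; rewrite /sinh_ divr_ge0 // subr_ge0 ler_expR; lra. Qed.

Lemma le_cosh x y : 0 <= x -> x <= y -> cosh_ x <= cosh_ y.
Proof.
move=> x0 xy.
have [c cxy e] := is_derive_MVT xy (fun t _ => is_derive_cosh t).
rewrite -subr_ge0 e mulr_ge0 ?subr_ge0 // sinh_ge0 //.
by move: cxy; rewrite in_itv /= => /andP[xc _]; apply: le_trans xc.
Qed.

Lemma sinhD x y : sinh_ (x + y) = sinh_ x * cosh_ y + cosh_ x * sinh_ y.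
Proof. by rewrite /cosh_ /sinh_ opprD !expRD; field. Qed.

Lemma coshN x : cosh_ (- x) = cosh_ x.
Proof. by rewrite /cosh_ opprK addrC. Qed.

Lemma sinhN x : sinh_ (- x) = - sinh_ x.
Proof. by rewrite /sinh_ opprK -mulNr opprB. Qed.

Lemma cosh2D1 x : cosh_ (x + x) = 1 + 2 * sinh_ x ^+ 2.
Proof.
have e : expR (- x) * expR x = 1 by rewrite -expRD addrC subrr expR0.
rewrite /cosh_ /sinh_ opprD !expRD; nra.
Qed.

Lemma sin_mean q : 0 <= q -> exists2 c, c \in `[0, q] & sin q = cos c * q.
Proof.
move=> q0; have [c ? e] := is_derive_MVT q0 (fun t _ => is_derive_sin t).
by exists c => //; rewrite -[LHS]subr0 -[in LHS](@sin0 R) e subr0.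
Qed.

Lemma sinh_mean q : 0 <= q -> exists2 c, c \in `[0, q] & sinh_ q = cosh_ c * q.
Proof.
move=> q0; have [c ? e] := is_derive_MVT q0 (fun t _ => is_derive_sinh t).
by exists c => //; rewrite -[LHS]subr0 -[in LHS]sinh0 e subr0.
Qed.

(** Concavity of sin: the chord slopes over [0, q] and [q, p] are cosines at points c <= d, and cos
    decreases on [0, pi]. *)
Lemma sinc_noninc q p : 0 <= q -> q <= p -> p <= pi -> q * sin p <= p * sin q.
Proof.
move=> q0 qp ppi.
have [c] := sin_mean q0; rewrite in_itv /= => /andP[c0 cq] e.
have [d] := is_derive_MVT qp (fun t _ => is_derive_sin t).
rewrite in_itv /= => /andP[qd dp] e'.
have cdc : cos d <= cos c.
  rewrite leNgt; apply/negP; rewrite ltr_cos ?in_itv /=; first by lra.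
    by apply/andP; split; lra.
  by apply/andP; split; lra.
have -> : sin p = cos c * q + cos d * (p - q) by lra.
rewrite e; have := mulr_ge0 (mulr_ge0 q0 (_ : 0 <= p - q)) (_ : 0 <= cos c - cos d).
by rewrite !subr_ge0 => /(_ qp cdc); lra.
Qed.

Lemma sinhc_nondec q p : 0 <= q -> q <= p -> p * sinh_ q <= q * sinh_ p.
Proof.
move=> q0 qp.
have [c] := sinh_mean q0; rewrite in_itv /= => /andP[c0 cq] e.
have [d] := is_derive_MVT qp (fun t _ => is_derive_sinh t).
rewrite in_itv /= => /andP[qd dp] e'.
have cdc : cosh_ c <= cosh_ d by apply: le_cosh => //; lra.
have -> : sinh_ p = cosh_ c * q + cosh_ d * (p - q) by lra.
rewrite e; have := mulr_ge0 (mulr_ge0 q0 (_ : 0 <= p - q)) (_ : 0 <= cosh_ d - cosh_ c).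
by rewrite !subr_ge0 => /(_ qp cdc); lra.
Qed.

Lemma sin_le_id y : 0 <= y -> y <= pi -> sin y <= y.
Proof.
move=> y0 ypi; have [c _ ->] := sin_mean y0.
by rewrite -[leRHS]mul1r ler_wpM2r // cos_le1.
Qed.

Lemma mul_cos_le_sin y : 0 <= y -> y <= pi -> y * cos y <= sin y.
Proof.
move=> y0 ypi; have [c + ->] := sin_mean y0; rewrite in_itv /= => /andP[c0 cy].
rewrite mulrC ler_wpM2r // leNgt; apply/negP; rewrite ltr_cos ?in_itv /=; first lra.
  by apply/andP; split; lra.
by apply/andP; split; lra.
Qed.

Lemma id_le_sinh y : 0 <= y -> y <= sinh_ y.
Proof.
move=> y0; have [c + ->] := sinh_mean y0; rewrite in_itv /= => /andP[c0 cy].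
by rewrite -[leLHS]mul1r ler_wpM2r // -cosh0 le_cosh.
Qed.

Lemma sinh_le_mul_cosh y : 0 <= y -> sinh_ y <= y * cosh_ y.
Proof.
move=> y0; have [c + ->] := sinh_mean y0; rewrite in_itv /= => /andP[c0 cy].
by rewrite mulrC ler_wpM2l // le_cosh.
Qed.

(* [cosq z] and [sinq z] are the entire functions cos(sqrt z) and
   sin(sqrt z) / sqrt z, restricted to the real line. *)
Definition cosq z : R := if 0 <= z then cos (Num.sqrt z) else cosh_ (Num.sqrt (- z)).
Definition sinq z : R :=
  if 0 < z then sin (Num.sqrt z) / Num.sqrt z
  else if z == 0 then 1 else sinh_ (Num.sqrt (- z)) / Num.sqrt (- z).

(** [Num.sqrt] is 0 on negative numbers, so one factor is always 1; this form has no case split and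
    yields continuity at 0. *)
Lemma cosqE z : cosq z = cos (Num.sqrt z) * cosh_ (Num.sqrt (- z)).
Proof.
rewrite /cosq; case: ifPn => [z0|]; last rewrite -ltNge => /ltW z0.
  by rewrite [Num.sqrt (- z)]ler0_sqrtr ?oppr_le0 // cosh0 mulr1.
by rewrite [Num.sqrt z]ler0_sqrtr // cos0 mul1r.
Qed.

Lemma continuous_cosq : continuous cosq.
Proof.
rewrite (_ : cosq = fun z => cos (Num.sqrt z) * cosh_ (Num.sqrt (- z))); last first.
  by apply/funext => z; exact: cosqE.
move=> z; apply: cvgM.
  by apply: continuous_comp; [exact: sqrt_continuous|exact: continuous_cos].
apply: (@continuous_comp _ _ _ (fun z : R => Num.sqrt (- z)) (@cosh_ R)).
  by apply: continuous_comp; [exact: opp_continuous|exact: sqrt_continuous].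
by apply/differentiable_continuous/derivable1_diffP; have [] := is_derive_cosh (Num.sqrt (- z)).
Qed.

Lemma cosq0 : cosq 0 = 1.
Proof. by rewrite /cosq lexx sqrtr0 cos0. Qed.

Lemma cosq_ge0E y : 0 <= y -> cosq (y ^+ 2) = cos y.
Proof. by move=> y0; rewrite /cosq sqr_ge0 sqrtr_sqr ger0_norm. Qed.

Lemma cosq_sqr x : cosq (x ^+ 2) = cos x.
Proof.
rewrite -real_normK ?num_real // cosq_ge0E //.
by have [_|_] := ger0P x; rewrite ?cosN.
Qed.

Lemma cosq_lt0E y : 0 < y -> cosq (- y ^+ 2) = cosh_ y.
Proof.
move=> y0; rewrite /cosq leNgt oppr_lt0 exprn_gt0 //= opprK sqrtr_sqr.
by rewrite ger0_norm // ltW.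
Qed.

Lemma sinq_gt0E y : 0 < y -> sinq (y ^+ 2) = sin y / y.
Proof. by move=> y0; rewrite /sinq exprn_gt0 // sqrtr_sqr gtr0_norm. Qed.

Lemma sinq_lt0E y : 0 < y -> sinq (- y ^+ 2) = sinh_ y / y.
Proof.
move=> y0; rewrite /sinq ltNge oppr_le0 sqr_ge0 /= oppr_eq0 sqrf_eq0 gt_eqF //.
by rewrite opprK sqrtr_sqr gtr0_norm.
Qed.

Lemma sinq0 : sinq 0 = 1.
Proof. by rewrite /sinq ltxx eqxx. Qed.

(* Every real is y ^+ 2, 0 or - y ^+ 2 with y > 0: removes the square roots. *)
Variant signed_sqr_spec : R -> Type :=
| SignedSqrPos y of 0 < y : signed_sqr_spec (y ^+ 2)
| SignedSqr0 : signed_sqr_spec 0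
| SignedSqrNeg y of 0 < y : signed_sqr_spec (- y ^+ 2).

Lemma signed_sqrP z : signed_sqr_spec z.
Proof.
have [z0|z0|->] := ltgtP z 0; last exact: SignedSqr0.
- rewrite -[z]opprK -[- z]sqr_sqrtr ?oppr_ge0 ?ltW //.
  by apply: SignedSqrNeg; rewrite sqrtr_gt0 oppr_gt0.
- rewrite -[z]sqr_sqrtr ?ltW //.
  by apply: SignedSqrPos; rewrite sqrtr_gt0.
Qed.

Lemma cosq_gt0 z : z < (pi / 2) ^+ 2 -> 0 < cosq z.
Proof.
have pi0 := pi_gt0 R.
case: (signed_sqrP z) => [y y0|_|y y0 _]; last 2 first.
- by rewrite cosq0.
- by rewrite cosq_lt0E // cosh_gt0.
rewrite ltr_sqr ?nnegrE //; [|by lra..] => yp.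
by rewrite cosq_ge0E ?ltW // cos_gt0_pihalf // yp andbT; lra.
Qed.

Lemma sinq_gt0 z : z < (pi / 2) ^+ 2 -> 0 < sinq z.
Proof.
have pi0 := pi_gt0 R.
case: (signed_sqrP z) => [y y0|_|y y0 _]; last 2 first.
- by rewrite sinq0.
- by rewrite sinq_lt0E // divr_gt0 // (lt_le_trans y0) // id_le_sinh // ltW.
rewrite ltr_sqr ?nnegrE //; [|by lra..] => yp.
by rewrite sinq_gt0E // divr_gt0 // sin_gt0_pi // y0 /=; lra.
Qed.

Let ratio_le (a b c d x y : R) : 0 < x -> 0 < y ->
  y * (a * c) <= x * (b * d) -> a / x * c <= b / y * d.
Proof.
move=> x0 y0 h; rewrite -subr_ge0.
have -> : b / y * d - a / x * c = (x * (b * d) - y * (a * c)) / (x * y).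
  by field; rewrite !gt_eqF.
by rewrite divr_ge0 ?subr_ge0 // mulr_ge0 // ltW.
Qed.

(* For two points of the same sign, sum-to-product formulas turn the claim into
   the monotonicity of sin x / x (resp. sinh x / x) at y - x and y + x. *)
Lemma tanq_nondec z w : z <= w -> w < (pi / 2) ^+ 2 ->
  sinq z / cosq z <= sinq w / cosq w.
Proof.
have pi0 := pi_gt0 R.
move=> zw wpi.
have cz := cosq_gt0 (le_lt_trans zw wpi); have cw := cosq_gt0 wpi.
rewrite ler_pdivrMr // mulrAC ler_pdivlMr //.
have sz := sinq_gt0 (le_lt_trans zw wpi); have sw := sinq_gt0 wpi.
have T0 (y : R) : 0 < y -> sinq (- y ^+ 2) <= cosq (- y ^+ 2).
  move=> y0; rewrite sinq_lt0E // cosq_lt0E // ler_pdivrMr // mulrC.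
  by rewrite sinh_le_mul_cosh // ltW.
have T1 (y : R) : 0 < y -> y ^+ 2 < (pi / 2) ^+ 2 -> cosq (y ^+ 2) <= sinq (y ^+ 2).
  move=> y0; rewrite ltr_sqr ?nnegrE //; [|by lra..] => yp.
  rewrite sinq_gt0E // cosq_ge0E; last exact: ltW.
  rewrite ler_pdivlMr // mulrC.
  by rewrite mul_cos_le_sin //; lra.
case: (signed_sqrP z) zw cz sz => [x x0|zw cz sz|x x0 zw cz sz].
- move=> xw cz sz; case: (signed_sqrP w) xw wpi cw sw => [y y0|xw|y y0 xw]; last 2 first.
  + by have := exprn_gt0 2 x0; lra.
  + by have := exprn_gt0 2 x0; have := exprn_gt0 2 y0; lra.
  rewrite ler_sqr ?ltr_sqr ?nnegrE //; [|by lra..] => xy yp _ _.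
  rewrite !sinq_gt0E // !cosq_ge0E; [|by lra..].
  apply: ratio_le => //.
  have := @sinc_noninc (y - x) (x + y) _ _ _; rewrite sinD sinB.
  by move=> /(_ ltac:(lra) ltac:(lra) ltac:(lra)); lra.
- rewrite sinq0 cosq0 mul1r mulr1.
  case: (signed_sqrP w) zw wpi cw sw => [y y0 _ yp _ _|_|y y0 xw]; first exact: T1.
    by rewrite sinq0 cosq0.
  by have := exprn_gt0 2 y0; lra.
- have := T0 x x0.
  case: (signed_sqrP w) zw wpi cw sw => [y y0 _ yp cw sw T|_ _ _ _|y y0].
  + apply: le_trans (ler_wpM2r (ltW cw) T) _; rewrite mulrC.
    by rewrite ler_pM2r // T1.
  + by rewrite sinq0 cosq0 mul1r mulr1.
  + rewrite lerN2 ler_sqr ?nnegrE; [|by lra..] => yx _ _ _ _.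
    rewrite !sinq_lt0E // !cosq_lt0E //.
    apply: ratio_le => //.
    have := @sinhc_nondec (x - y) (x + y) _ _; rewrite !sinhD coshN sinhN.
    by move=> /(_ ltac:(lra) ltac:(lra)); lra.
Qed.

(* With z = y ^+ 2, cosq z - 1 = - 2 sin^2 (y / 2), and likewise with sinh for
   z < 0; this is what makes cosq differentiable at the junction point 0. *)
Lemma cosq_difference_quotient z : z != 0 -> `|z| < 1 ->
  `|(- (1 / 2)) - (cosq z - 1) / z| <= `|1 / 2 - cosq (z / 4) ^+ 2 / 2|.
Proof.
have pi2 := pi_ge2 R.
case: (signed_sqrP z) => [y y0 _|/eqP //|y y0 _].
- rewrite ger0_norm ?sqr_ge0 // expr_lt1 //; last exact: ltW.
  move=> y1.
  rewrite (_ : y ^+ 2 / 4 = (y / 2) ^+ 2); last by field.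
  rewrite !cosq_ge0E; [|lra..].
  rewrite [in cos y](_ : y = y / 2 + y / 2); last by field.
  have -> : cos (y / 2 + y / 2) = 1 - 2 * sin (y / 2) ^+ 2.
    by rewrite cosD; have := sin2cos2 (y / 2); nra.
  have [s1 s2] : y / 2 * cos (y / 2) <= sin (y / 2) /\ sin (y / 2) <= y / 2.
    by rewrite mul_cos_le_sin ?sin_le_id //; lra.
  have c0 : 0 < cos (y / 2) by apply: cos_gt0_pihalf; lra.
  have s0 : 0 <= sin (y / 2) by apply: le_trans s1; rewrite mulr_ge0 //; lra.
  set s := sin _ in s1 s2 s0 *; set c := cos _ in s1 c0 *.
  have e : (1 - 2 * s ^+ 2 - 1) / y ^+ 2 = - (2 * (s / y) ^+ 2).
    by field; rewrite gt_eqF.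
  rewrite e.
  have t1 : c / 2 <= s / y by rewrite ler_pdivlMr //; lra.
  have t2 : s / y <= 1 / 2 by rewrite ler_pdivrMr //; lra.
  have t0 : 0 <= s / y by rewrite divr_ge0 // ltW.
  set t := s / y in t0 t1 t2 *.
  have u1 : (c / 2) ^+ 2 <= t ^+ 2 by rewrite ler_sqr ?nnegrE //; lra.
  have u2 : t ^+ 2 <= (1 / 2) ^+ 2 by rewrite ler_sqr ?nnegrE //; lra.
  rewrite ler0_norm; last by lra.
  by rewrite ger0_norm; lra.
- move=> _; rewrite (_ : - y ^+ 2 / 4 = - (y / 2) ^+ 2); last by field.
  have y20 : 0 < y / 2 by lra.
  rewrite !cosq_lt0E //.
  rewrite [in cosh_ y](_ : y = y / 2 + y / 2); last by field.
  rewrite cosh2D1.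
  have [s1 s2] : sinh_ (y / 2) <= y / 2 * cosh_ (y / 2) /\ y / 2 <= sinh_ (y / 2).
    by rewrite id_le_sinh ?sinh_le_mul_cosh //; lra.
  have c0 := cosh_gt0 (y / 2).
  set s := sinh_ _ in s1 s2 *; set c := cosh_ _ in s1 c0 *.
  have e : (1 + 2 * s ^+ 2 - 1) / - y ^+ 2 = - (2 * (s / y) ^+ 2).
    by field; rewrite gt_eqF.
  rewrite e.
  have t1 : s / y <= c / 2 by rewrite ler_pdivrMr //; lra.
  have t2 : 1 / 2 <= s / y by rewrite ler_pdivlMr //; lra.
  set t := s / y in t1 t2 *.
  have u1 : t ^+ 2 <= (c / 2) ^+ 2 by rewrite ler_sqr ?nnegrE //; lra.
  have u2 : (1 / 2) ^+ 2 <= t ^+ 2 by rewrite ler_sqr ?nnegrE //; lra.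
  rewrite ger0_norm; last by lra.
  by rewrite ler0_norm; lra.
Qed.

Lemma is_derive_cosq z : is_derive z 1 cosq (- (sinq z / 2)).
Proof.
case: (signed_sqrP z) => [y y0||y y0].
- have z0 : 0 < y ^+ 2 by rewrite exprn_gt0.
  apply: (@near_eq_is_derive _ _ _ (fun t => cos (Num.sqrt t))).
    near=> t; rewrite /cosq ifT //.
    by apply: ltW; near: t; exact: lt_nbhsr.
  have d := @is_derive1_comp R cos Num.sqrt _ _ _ (is_derive_cos _) (is_derive1_sqrt z0).
  apply: (is_derive_eq d).
  by rewrite sinq_gt0E // sqrtr_sqr gtr0_norm //; field; rewrite gt_eqF.
- rewrite sinq0; apply/is_derive1_caratheodory.
  (* Caratheodory slope at 0, filled in by the claimed derivative - 1 / 2. It is continuous there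
     because the error bound tends to 0, as [cosq] is continuous with [cosq 0] = 1. *)
  exists (fun t => if t == 0 then - (1 / 2) else (cosq t - 1) / t); split.
  + move=> t; rewrite cosq0 subr0; case: eqVneq => [->|t0].
      by rewrite cosq0 subrr mulr0.
    by rewrite divfK.
  + rewrite /prop_for /continuous_at /= eqxx; apply/cvgrPdist_le => e e0.
    have c0 : `|1 / 2 - cosq (t / 4) ^+ 2 / 2| @[t --> (0 : R)]
        --> `|1 / 2 - cosq (0 / 4) ^+ 2 / 2|.
      have c1 : cosq (t / 4) @[t --> (0 : R)] --> cosq (0 / 4).
        apply: (@continuous_comp _ _ _ (fun t : R => t / 4) cosq).
          exact: mulrr_continuous.
        exact: continuous_cosq.
      apply: cvg_norm; apply: cvgB; first exact: cvg_cst.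
      by apply: cvgM; [exact: cvgM|exact: cvg_cst].
    rewrite mul0r cosq0 expr1n subrr normr0 in c0.
    have /cvgrPdist_le/(_ e e0) c1 := c0.
    near=> t; case: eqVneq => [_|t0]; first by rewrite subrr normr0 ltW.
    apply: le_trans (cosq_difference_quotient t0 _) _.
      near: t; exists 1 => //= t /=; rewrite sub0r normrN //.
    have : `|0 - `|1 / 2 - cosq (t / 4) ^+ 2 / 2| | <= e by near: t.
    by rewrite sub0r normrN normr_id.
  + by rewrite eqxx.
- have z0 : 0 < - (- y ^+ 2) by rewrite opprK exprn_gt0.
  apply: (@near_eq_is_derive _ _ _ (fun t => cosh_ (Num.sqrt (- t)))).
    near=> t; rewrite /cosq ifF //; apply/negbTE; rewrite -ltNge.
    by near: t; apply: lt_nbhsl; rewrite -oppr_gt0.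
  have dN : is_derive (- y ^+ 2) 1 (fun t : R => - t) (- 1).
    by apply: is_derive_eq.
  have d1 := @is_derive1_comp R Num.sqrt (fun t => - t) _ _ _ (is_derive1_sqrt z0) dN.
  have d := @is_derive1_comp R (@cosh_ R) _ _ _ _ (is_derive_cosh _) d1.
  apply: (is_derive_eq d) => /=.
  by rewrite sinq_lt0E // opprK sqrtr_sqr gtr0_norm //; field; rewrite gt_eqF.
Unshelve. all: by end_near. Qed.

Lemma tangent_le f df b x y :
  (forall t, t < b -> is_derive t 1 f (df t)) ->
  (forall s t, s <= t -> t < b -> df s <= df t) ->
  x < b -> y < b -> f x + df x * (y - x) <= f y.
Proof.
move=> fdf mono xb yb; have [xy|/ltW yx] := leP x y.
- have d t : t \in `[x, y] -> is_derive t 1 f (df t).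
    by rewrite in_itv /= => /andP[_ ty]; apply: fdf; exact: le_lt_trans yb.
  have [c] := is_derive_MVT xy d; rewrite in_itv /= => /andP[xc cy] e.
  have h := mono _ _ xc (le_lt_trans cy yb).
  by have := ler_wpM2r (_ : 0 <= y - x) h; rewrite subr_ge0 => /(_ xy); lra.
- have d t : t \in `[y, x] -> is_derive t 1 f (df t).
    by rewrite in_itv /= => /andP[_ ty]; apply: fdf; exact: le_lt_trans xb.
  have [c] := is_derive_MVT yx d; rewrite in_itv /= => /andP[yc cx] e.
  have h := mono _ _ cx xb.
  by have := ler_wpM2r (_ : 0 <= x - y) h; rewrite subr_ge0 => /(_ yx); lra.
Qed.

(** Growth is at most exp(sqrt |z|), and y <= e y^2 + 1 / (4 e) by completing the square. The rate
    [e] stays free so that it can be tuned against the exponential growth of the moment generating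
    function. *)
Lemma cosq_le_expR e z : 0 < e -> cosq z <= expR (e * `|z| + 1 / (4 * e)).
Proof.
move=> e0.
have amgm y : 0 <= y -> y <= e * y ^+ 2 + 1 / (4 * e).
  move=> y0; rewrite -subr_ge0.
  have -> : e * y ^+ 2 + 1 / (4 * e) - y = e * (y - 1 / (2 * e)) ^+ 2.
    by field; rewrite gt_eqF.
  by rewrite mulr_ge0 ?sqr_ge0 // ltW.
have ge0 : 0 <= e * `|z| + 1 / (4 * e).
  apply: addr_ge0; first exact: mulr_ge0 (ltW e0) (normr_ge0 _).
  by apply: divr_ge0 => //; apply: mulr_ge0 => //; exact: ltW.
case: (signed_sqrP z) ge0 => [y y0||y y0] ge0.
- rewrite cosq_ge0E; last exact: ltW.
  apply: le_trans (cos_le1 _) _; rewrite -[leLHS]expR0 ler_expR.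
  exact: ge0.
- rewrite cosq0 -[leLHS]expR0 ler_expR.
  exact: ge0.
- rewrite cosq_lt0E // normrN ger0_norm ?sqr_ge0 //.
  apply: (@le_trans _ _ (expR y)); last by rewrite ler_expR amgm // ltW.
  rewrite /cosh_ ler_pdivrMr // mulrC.
  have : expR (- y) <= expR y by rewrite ler_expR; lra.
  lra.
Qed.

Lemma cos_pi_sqrtE s : cos_pi_sqrt s = cosq (pi ^+ 2 * s).
Proof.
have pi0 := pi_gt0 R.
have e (t : R) : Num.sqrt (pi ^+ 2 * t) = pi * Num.sqrt t.
  by rewrite sqrtrM ?sqr_ge0 // sqrtr_sqr gtr0_norm.
by rewrite /cos_pi_sqrt /cosq pmulr_rge0 ?exprn_gt0 // -mulrN !e.
Qed.

End RealFunctions.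

(** * The function Lambda_kappa *)

Section LambdaKappa.
Context {R : realType} (kappa : R).
Hypothesis kappaP : 8 / 3 < kappa < 8.
Implicit Types l : R.

Definition lmax : R := 1 - 2 / kappa - 3 * kappa / 32.
(** With this argument [cosq] is the denominator in Lambda_kappa. It is affine in l and reaches (pi
    / 2)^2, the first zero of [cosq], exactly at [lmax]. *)
Definition phase l : R := pi ^+ 2 * ((1 - 4 / kappa) ^+ 2 + 8 * l / kappa).
Definition amp : R := - cos (4 * pi / kappa).
Definition Lk l : R := ln (amp / cosq (phase l)).
Definition dLk l : R := 4 * pi ^+ 2 / kappa * (sinq (phase l) / cosq (phase l)).

Let kappa_gt0 : 0 < kappa. Proof. by case/andP: kappaP; lra. Qed.

Lemma lmax_gt0 : 0 < lmax.
Proof.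
case/andP: kappaP => k1 k2; rewrite /lmax.
have -> : 1 - 2 / kappa - 3 * kappa / 32 = (8 - kappa) * (3 * kappa - 8) / (32 * kappa).
  by field; rewrite gt_eqF.
by rewrite divr_gt0 ?mulr_gt0 //; lra.
Qed.

Lemma phase_lmax : phase lmax = (pi / 2) ^+ 2.
Proof. by rewrite /phase /lmax; field; rewrite gt_eqF. Qed.

Lemma phaseB l l' : phase l' = phase l + 8 * pi ^+ 2 / kappa * (l' - l).
Proof. by rewrite /phase; field; rewrite gt_eqF. Qed.

Let slope_gt0 : 0 < 8 * pi ^+ 2 / kappa.
Proof. by rewrite divr_gt0 ?mulr_gt0 ?exprn_gt0 // pi_gt0. Qed.

Lemma le_phase l l' : l <= l' -> phase l <= phase l'.
Proof. by move=> ll'; rewrite (phaseB l l') lerDl mulr_ge0 ?subr_ge0 // ltW. Qed.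

Lemma phase_lt l : l < lmax -> phase l < (pi / 2) ^+ 2.
Proof. by move=> h; rewrite -phase_lmax (phaseB l lmax) ltrDl mulr_gt0 ?subr_gt0. Qed.

Lemma cosq_phase0 : cosq (phase 0) = amp.
Proof.
rewrite /phase mulr0 mul0r addr0 -exprMn cosq_sqr /amp.
have -> : pi * (1 - 4 / kappa) = pi - 4 * pi / kappa by field; rewrite gt_eqF.
by rewrite cosB cospi sinpi mul0r addr0 mulN1r.
Qed.

(** Since 0 < [lmax], [phase 0] lies below the first zero of [cosq], and [amp] is the value of
    [cosq] there. *)
Lemma amp_gt0 : 0 < amp.
Proof. by rewrite -cosq_phase0 cosq_gt0 // phase_lt // lmax_gt0. Qed.

Lemma is_derive_Lk l : l < lmax -> is_derive l 1 Lk (dLk l).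
Proof.
move=> lM; have c0 := cosq_gt0 (phase_lt lM); have a0 := amp_gt0.
have dp : is_derive l 1 phase (8 * pi ^+ 2 / kappa).
  rewrite /phase; apply: is_derive_eq; rewrite /GRing.scale /=; field.
  by rewrite gt_eqF.
have dc := @is_derive1_comp R cosq phase _ _ _ (is_derive_cosq _) dp.
have dv := is_deriveV (_ : (cosq \o phase) l != 0) dc.
have dl : is_derive (amp / cosq (phase l)) 1 (@ln R) (amp / cosq (phase l))^-1.
  by apply: is_derive1_ln; rewrite divr_gt0.
have da := @is_deriveZ _ _ _ (fun y => ((cosq \o phase) y)^-1) amp l 1 _ (dv (lt0r_neq0 c0)).
have d := @is_derive1_comp R (@ln R) (fun y => amp / cosq (phase y)) _ _ _ dl da.
apply: (is_derive_eq d); rewrite /dLk /GRing.scale /=; field.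
by rewrite !gt_eqF.
Qed.

Lemma dLk_gt0 l : l < lmax -> 0 < dLk l.
Proof.
move=> /phase_lt h; rewrite /dLk mulr_gt0 ?divr_gt0 ?cosq_gt0 ?sinq_gt0 //.
by rewrite mulr_gt0 // exprn_gt0 // pi_gt0.
Qed.

Lemma Lk_tangent l l' : l < lmax -> l' < lmax ->
  Lk l + dLk l * (l' - l) <= Lk l'.
Proof.
apply: tangent_le; first exact: is_derive_Lk.
move=> s t st /phase_lt tb; rewrite /dLk ler_pM2l; last first.
  by rewrite divr_gt0 ?mulr_gt0 ?exprn_gt0 // pi_gt0.
by apply: tanq_nondec => //; exact: le_phase.
Qed.

Lemma expR_Lk l : l < lmax -> expR (Lk l) * cosq (phase l) = amp.
Proof.
move=> /phase_lt/cosq_gt0 c0.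
by rewrite /Lk lnK ?posrE ?divr_gt0 ?amp_gt0 // divfK // gt_eqF.
Qed.

Lemma Lk0 : Lk 0 = 0.
Proof. by rewrite /Lk cosq_phase0 divff ?ln1 // gt_eqF // amp_gt0. Qed.

Lemma continuous_cosq_phase : continuous (fun l => cosq (phase l)).
Proof.
move=> l; apply: (@continuous_comp _ _ _ phase cosq); last exact: continuous_cosq.
rewrite /phase; apply: cvgM; first exact: cvg_cst.
apply: cvgD; first exact: cvg_cst.
by apply: cvgM; [apply: cvgM; [exact: cvg_cst|exact: cvg_id]|exact: cvg_cst].
Qed.

Lemma cosq_phase_lmax : cosq (phase lmax) = 0.
Proof.
by rewrite phase_lmax cosq_ge0E ?cos_pihalf // divr_ge0 // pi_ge0.
Qed.

(** The intermediate value theorem is applied to [cosq (phase l)], which stays continuous up to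
    [lmax], where it vanishes and Lambda_kappa blows up. *)
Lemma Lk_surj c : 0 <= c -> exists2 l, l < lmax & Lk l = c.
Proof.
move=> c0; have M0 := lmax_gt0; have a0 := amp_gt0.
have ce : expR (- c) <= 1 by rewrite -expR0 ler_expR; lra.
have [] := @IVT R (fun l => cosq (phase l)) 0 lmax (amp * expR (- c)) (ltW M0).
- exact/continuous_subspaceT/continuous_cosq_phase.
- rewrite cosq_phase0 cosq_phase_lmax ge_min le_max.
  by rewrite !ler_piMr ?mulr_ge0 ?expR_ge0 ?orbT // ltW.
move=> l; rewrite in_itv /= => /andP[_ lM] e; exists l.
  rewrite lt_neqAle lM andbT; apply/eqP => lE; move: e.
  by rewrite lE cosq_phase_lmax => /esym/eqP; rewrite gt_eqF // mulr_gt0 // expR_gt0.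
by rewrite /Lk e invfM mulrA divff ?gt_eqF // mul1r expRN invrK expRK.
Qed.

Lemma Lambda_kappaE l : Lambda_kappa kappa l = if l < lmax then (Lk l)%:E else +oo%E.
Proof. by rewrite /Lambda_kappa cos_pi_sqrtE. Qed.

End LambdaKappa.

(** * The moment generating function *)

Section MomentGeneratingFunction.
Context {R : realType} (mu : probability R R).
Implicit Types (l s t a b c x : R).

Definition mgf l : \bar R := (\int[mu]_x (expR (l * x))%:E)%E.

Lemma measurable_expR_mul l :
  measurable_fun [set: R] (fun x : R => (expR (l * x))%:E : \bar R).
Proof.
apply/measurable_EFinP; apply: measurableT_comp; first exact: measurable_expR.
exact: mulrl_measurable.
Qed.

Lemma mgf0 : mgf 0 = 1%E.
Proof.
rewrite /mgf; under eq_integral do rewrite mul0r expR0.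
by rewrite integral_cst // mul1e; exact: probability_setT.
Qed.

(** A zero integral would make the integrand vanish almost everywhere; as it vanishes nowhere, the
    whole line would be null. *)
Lemma mgf_gt0 l : (0 < mgf l)%E.
Proof.
rewrite lt_def; apply/andP; split; last first.
  by apply: integral_ge0 => x _; rewrite lee_fin expR_ge0.
apply/eqP => e.
have : (\int[mu]_x `|(expR (l * x))%:E| = 0)%E.
  by rewrite -e; apply: eq_integral => x _; rewrite gee0_abs // lee_fin expR_ge0.
move/ae_eq_integral_abs => /(_ measurableT (measurable_expR_mul l)) [N [mN N0 sN]].
have NT : N = setT.
  apply/seteqP; split => // x _; apply: sN => /= /(_ Logic.I) [].
  by apply/eqP; rewrite gt_eqF // expR_gt0.
by have := probability_setT mu; rewrite -NT N0 => /esym/eqP; rewrite onee_eq0.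
Qed.

Lemma expR_convex u v t : 0 <= t <= 1 ->
  expR (u + t * (v - u)) <= (1 - t) * expR u + t * expR v.
Proof.
move=> /andP[t0 t1]; set m := u + t * (v - u).
have h w : expR m * (1 + (w - m)) <= expR w.
  have -> : expR w = expR m * expR (w - m) by rewrite -expRD; congr expR; ring.
  by rewrite ler_wpM2l ?expR_ge0 // expR_ge1Dx.
have := ler_wpM2l t0 (h v).
have := ler_wpM2l (_ : 0 <= 1 - t) (h u); rewrite subr_ge0 => /(_ t1).
have : (1 - t) * (expR m * (1 + (u - m))) + t * (expR m * (1 + (v - m))) = expR m.
  by rewrite /m; ring.
lra.
Qed.

(** Hoelder's inequality, by normalising both exponentials to integral 1 and using convexity of exp
    pointwise. *)
Lemma mgf_log_convex l0 l1 a b t : 0 <= t <= 1 ->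
  mgf l0 = (expR a)%:E -> mgf l1 = (expR b)%:E ->
  (mgf (l0 + t * (l1 - l0)) <= (expR (a + t * (b - a)))%:E)%E.
Proof.
move=> t01 e0 e1; have /andP[t0 t1] := t01.
set E := expR (a + t * (b - a)).
(* Weights chosen so that c0 mgf(l0) + c1 mgf(l1) = E. *)
pose c0 := E * ((1 - t) * expR (- a)); pose c1 := E * (t * expR (- b)).
have c00 : 0 <= c0 by rewrite !mulr_ge0 ?expR_ge0 ?subr_ge0.
have c10 : 0 <= c1 by rewrite !mulr_ge0 ?expR_ge0.
have pw x : expR ((l0 + t * (l1 - l0)) * x) <= c0 * expR (l0 * x) + c1 * expR (l1 * x).
  have -> : expR ((l0 + t * (l1 - l0)) * x) =
      E * expR ((l0 * x - a) + t * ((l1 * x - b) - (l0 * x - a))).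
    by rewrite /E -expRD; congr expR; ring.
  rewrite /c0 /c1 -!mulrA -mulrDr ler_wpM2l ?expR_ge0 // -!expRD.
  rewrite [- a + _]addrC [- b + _]addrC.
  exact: expR_convex.
apply: (@le_trans _ _ (\int[mu]_x (c0%:E * (expR (l0 * x))%:E + c1%:E * (expR (l1 * x))%:E))%E).
  apply: ge0_le_integral => //.
  - exact: measurable_expR_mul.
  - by apply: emeasurable_funD; apply: measurable_funeM; exact: measurable_expR_mul.
  - by move=> x _; rewrite -!EFinM -EFinD lee_fin pw.
rewrite ge0_integralD //; first last.
- by apply: measurable_funeM; exact: measurable_expR_mul.
- by move=> x _; rewrite -EFinM lee_fin mulr_ge0 // expR_ge0.
- by apply: measurable_funeM; exact: measurable_expR_mul.
- by move=> x _; rewrite -EFinM lee_fin mulr_ge0 // expR_ge0.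
rewrite !ge0_integralZl_EFin //; first last.
- exact: measurable_expR_mul.
- exact: measurable_expR_mul.
rewrite -/(mgf l0) -/(mgf l1) e0 e1 -!EFinM -EFinD lee_fin /c0 /c1.
have h (w : R) : expR (- w) * expR w = 1 by rewrite -expRD addNr expR0.
have fin (e A A' B B' : R) : A * A' = 1 -> B * B' = 1 ->
    e * ((1 - t) * A) * A' + e * (t * B) * B' <= e.
  move=> hA hB; have -> : e * ((1 - t) * A) * A' + e * (t * B) * B' =
    e * ((1 - t) * (A * A') + t * (B * B')) by ring.
  by rewrite hA hB !mulr1 subrK mulr1.
exact: fin (h a) (h b).
Qed.

(* Since exp(l x - |x| / n) <= exp(h x) whenever |l - h| <= 1 / n, monotone
   convergence of the left-hand sides replaces any integrability condition. *)
Lemma mgf_lower_semicontinuous l c :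
  (c%:E < mgf l)%E -> \forall h \near l, (c%:E < mgf h)%E.
Proof.
pose g n x := (expR (l * x - `|x| / n.+1%:R))%:E.
have mg n : measurable_fun [set: R] (g n).
  apply/measurable_EFinP; apply: measurableT_comp; first exact: measurable_expR.
  apply: measurable_funB; first exact: mulrl_measurable.
  by apply: measurable_funM => //; exact: measurableT_comp.
have g0 n x : setT x -> (0 <= g n x)%E by move=> _; rewrite lee_fin expR_ge0.
have ndg x : setT x -> nondecreasing_seq (g^~ x).
  move=> _ m n mn; rewrite lee_fin ler_expR lerD2l lerN2.
  by rewrite ler_wpM2l // lef_pV2 ?posrE ?ltr0n // ler_nat ltnS.
have gE x : limn (g^~ x) = (expR (l * x))%:E.
  apply/cvg_lim => //; apply: cvg_EFin; first exact: nearW.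
  have h : l * x - `|x| / n.+1%:R @[n --> \oo] --> l * x - `|x| * 0.
    apply: cvgB; first exact: cvg_cst.
    by apply: cvgM; [exact: cvg_cst|exact: cvg_harmonic].
  rewrite mulr0 subr0 in h.
  exact: (continuous_cvg _ (@continuous_expR R (l * x)) h).
move=> cl; have [N cN] : exists N, (c%:E < \int[mu]_x g N x)%E.
  apply: contrapT => /forallNP h; move: cl; apply/negP; rewrite -leNgt.
  have := @cvg_monotone_convergence _ _ _ mu setT measurableT g mg g0 ndg.
  rewrite (eq_integral (fun x => (expR (l * x))%:E)); last by move=> x _; exact: gE.
  by move=> /cvge_to_le; apply; apply: nearW => n; rewrite leNgt; apply/negP/h.
have N0 : (0 : R) < N.+1%:R^-1 by rewrite invr_gt0 ltr0n.
exists N.+1%:R^-1 => //= h' /= lh.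
apply: lt_le_trans cN _; apply: ge0_le_integral => //; first exact: g0.
  exact: measurable_expR_mul.
move=> x _; rewrite lee_fin ler_expR lerBlDr -lerBlDl -mulrBl.
apply: le_trans (ler_norm _) _; rewrite normrM mulrC ler_wpM2l //.
exact: ltW.
Qed.

Let measurable_halfline s c : measurable [set x : R | (c < s * x)%R].
Proof.
have := @mulrl_measurable R setT s measurableT _ (measurable_itv `]c, +oo[).
rewrite setTI; congr (measurable _); apply/seteqP; split => x /=.
  by rewrite in_itv /= andbT.
by rewrite in_itv /= andbT.
Qed.

(* The sign s = 1 or -1 selects the half-line (0, +oo) or (-oo, 0). *)
Lemma mgf_growth s : (0 < mu [set x | (0 < s * x)%R])%E ->
  exists p d : R, [/\ 0 < p, 0 < d & forall l, 0 <= l -> ((p * expR (d * l))%:E <= mgf (s * l))%E].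
Proof.
move=> pos.
(* Otherwise the half-line would be a countable union of null sets. The threshold 1 / (n + 1)
   becomes the growth rate d, and the mass beyond it becomes p. *)
have [n pn] : exists n : nat, (0 < mu [set x | (n.+1%:R^-1 < s * x)%R])%E.
  apply: contrapT => /forallNP h; move: pos; apply/negP; rewrite -leNgt.
  have -> : [set x : R | (0 < s * x)%R] = \bigcup_n [set x : R | (n.+1%:R^-1 < s * x)%R].
    apply/seteqP; split => x /=.
      move=> sx; exists (Num.truncn (s * x)^-1) => //=.
      rewrite invf_plt ?posrE ?ltr0n //.
      exact: truncnS_gt.
    by move=> [n _ /=]; apply: lt_trans; rewrite invr_gt0 ltr0n.
  rewrite (@measure_negligible _ _ _ mu) //.
    by apply: bigcup_measurable => n _; exact: measurable_halfline.
  apply: negligible_bigcup => n; apply/negligibleP; first exact: measurable_halfline.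
  by apply/eqP; rewrite eq_le measure_ge0 andbT leNgt; exact/negP/h.
set A := [set x : R | _] in pn; have mA : measurable A by exact: measurable_halfline.
have fA : mu A \is a fin_num by exact: fin_num_measure.
exists (fine (mu A)), n.+1%:R^-1; split.
- by rewrite -lte_fin fineK.
- by rewrite invr_gt0 ltr0n.
move=> l l0; rewrite mulrC EFinM fineK //.
rewrite -(@integral_cst _ _ _ mu A mA).
apply: (@le_trans _ _ (\int[mu]_(x in A) (expR (s * l * x))%:E)%E).
  apply: ge0_le_integral => //.
  - by move=> x _; rewrite lee_fin expR_ge0.
  - by apply: measurable_funTS; exact: measurable_expR_mul.
  move=> x; rewrite /A /= => /ltW h; rewrite lee_fin ler_expR.
  by rewrite mulrAC ler_wpM2r.
apply: ge0_subset_integral => //.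
exact: measurable_expR_mul.
Qed.

Lemma mgf_le1 s l : mu [set x | (0 < s * x)%R] = 0%E -> 0 <= l -> (mgf (s * l) <= 1)%E.
Proof.
move=> n0 l0; rewrite -(@probability_setT _ _ _ mu) -[leRHS]mul1e -integral_cst //.
apply: ae_ge0_le_integral => //.
  exact: measurable_expR_mul.
exists [set x | (0 < s * x)%R]; split => //.
move=> x /= h; rewrite ltNge; apply/negP => sx; apply: h => _.
rewrite lee_fin -expR0 ler_expR mulrAC; exact: mulr_le0_ge0.
Qed.

End MomentGeneratingFunction.

(** * Duality *)

Section Perspective.
Context {R : realType}.
Implicit Types (N : R -> \bar R) (f : R -> R) (x d w e nu l a u s alpha : R).

(** The Caratheodory slope is continuous, so near x it differs little from d; the slack [e] absorbs
    the difference. *)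
Lemma is_derive_upper_bound f x d w e : is_derive x 1 f d -> 0 < e ->
  \forall t \near 0^'+, f (x + t * w) <= f x + t * (w * d + e).
Proof.
move=> /is_derive1_caratheodory [g [fg cg gx]] e0.
have cgw : g (x + t * w) * w @[t --> (0 : R)] --> g x * w.
  apply: cvgM; last exact: cvg_cst.
  have h : x + t * w @[t --> (0 : R)] --> x + 0 * w.
    by apply: cvgD; [exact: cvg_cst|apply: cvgM; [exact: cvg_id|exact: cvg_cst]].
  by rewrite mul0r addr0 in h; exact: (cvg_comp _ _ h cg).
have nr : \forall t \near (0 : R), g (x + t * w) * w < w * d + e.
  apply: (cvgr_lt _ cgw); rewrite gx; lra.
near=> t.
have t0 : 0 < t by [].
have gt : g (x + t * w) * w < w * d + e.
  by near: t; apply: cvg_within.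
have -> : f (x + t * w) = f x + t * (g (x + t * w) * w).
  by have := fg (x + t * w); lra.
by rewrite lerD2l ler_pM2l // ltW.
Unshelve. all: by end_near. Qed.

(** Multiplication by nu turns the transform into a supremum of l alpha - nu N(l), which is affine
    in nu. *)
Lemma perspective_ge N nu l a alpha : 0 < nu -> N l = a%:E ->
  ((l * alpha - nu * a)%:E <= nu%:E * legendre N (alpha / nu))%E.
Proof.
move=> nu0 Nl.
have -> : l * alpha - nu * a = nu * (l * (alpha / nu) - a).
  by field; rewrite gt_eqF.
rewrite EFinM lee_pmul2l // EFinB -Nl.
by apply: ereal_sup_ubound; exists l.
Qed.

Lemma perspective_le N nu u alpha : 0 < nu -> (forall l, N l != -oo%E) ->
  (forall l a, N l = a%:E -> l * alpha - nu * a <= u) ->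
  (nu%:E * legendre N (alpha / nu) <= u%:E)%E.
Proof.
move=> nu0 NN h.
have -> : u = nu * (u / nu) by field; rewrite gt_eqF.
rewrite EFinM lee_pmul2l //; apply: ge_ereal_sup => _ [l _ <-].
case Nl : (N l) (NN l) => [a| |] // _; last exact: leNye.
rewrite -EFinB lee_fin ler_pdivlMr //.
have -> : (l * (alpha / nu) - a) * nu = l * alpha - nu * a.
  by field; rewrite gt_eqF.
exact: h Nl.
Qed.

Lemma legendre_reflect N s x : s * s = 1 ->
  legendre N x = legendre (fun l => N (s * l)) (s * x).
Proof.
move=> s2; congr ereal_sup.
have e (a b : R) : s * a * (s * b) = a * b by rewrite mulrACA s2 mul1r.
apply/seteqP; split => _ [l _ <-]; exists (s * l) => //.
  by rewrite e mulrA s2 mul1r.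
by rewrite [s * l * x]mulrAC mulrC mulrA.
Qed.

End Perspective.

Section Duality.
Context {R : realType} (kappa : R).
Hypothesis kappaP : 8 / 3 < kappa < 8.
Implicit Types (N m : R -> \bar R) (nu l a u V alpha : R).

Local Notation M := (lmax kappa).
Local Notation K := (Lk kappa).
Local Notation dK := (dLk kappa).

Definition kpart nu : \bar R := (nu%:E * legendre (Lambda_kappa kappa) (1 / nu))%E.

(** [Lambda_mu] is abstracted to N so that its reflection l |-> N(s l) can take its place. *)
Definition gam N alpha nu : \bar R :=
  (nu%:E * legendre N (alpha / nu) + kpart nu)%E.

Lemma kpart_ge nu l : 0 < nu -> l < M -> ((l - nu * K l)%:E <= kpart nu)%E.
Proof.
move=> nu0 lM; have := @perspective_ge R (Lambda_kappa kappa) nu l (K l) 1 nu0.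
by rewrite mulr1; apply; rewrite Lambda_kappaE lM.
Qed.

Lemma kpart_le nu u : 0 < nu -> (forall l, l < M -> l - nu * K l <= u) ->
  (kpart nu <= u%:E)%E.
Proof.
move=> nu0 h; apply: perspective_le => // l; rewrite Lambda_kappaE; case: ifPn => // lM.
by move=> a [<-]; rewrite mulr1; exact: h.
Qed.

(** For nu = 1 / dK(l), the tangent inequality at l says that l' - nu K(l') is largest at l' = l. *)
Lemma kpart_tangent l : l < M -> (kpart (dK l)^-1 <= (l - (dK l)^-1 * K l)%:E)%E.
Proof.
move=> lM; have d0 := dLk_gt0 kappaP lM; apply: kpart_le; first by rewrite invr_gt0.
move=> l' l'M; have := Lk_tangent kappaP lM l'M; rewrite -subr_ge0 => h.
rewrite -subr_ge0.
have -> : l - (dK l)^-1 * K l - (l' - (dK l)^-1 * K l') =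
    (dK l)^-1 * (K l' - (K l + dK l * (l' - l))).
  by field; rewrite gt_eqF.
by rewrite mulr_ge0 // invr_ge0 ltW.
Qed.

(** The bound makes l an interior maximum of t - nu K(t), so the derivative 1 - nu dK(l)
    vanishes. *)
Lemma kpart_tangent_unique nu l : 0 < nu -> l < M ->
  (kpart nu <= (l - nu * K l)%:E)%E -> nu = (dK l)^-1.
Proof.
move=> nu0 lM h.
have d0 := dLk_gt0 kappaP lM; 
have dh t : t < M -> is_derive t 1 (fun t : R => t - nu * K t) (1 - nu * dK t).
  move=> tM; have dk := is_derive_Lk kappaP tM.
  exact: (is_deriveB (is_derive_id _ _) (is_deriveZ nu dk)).
have ab : l - 1 <= M by lra.
have e0 : is_derive l 1 (fun t : R => t - nu * K t) 0.
  apply: (derive1_at_max ab).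
  - by move=> t; rewrite in_itv /= => /andP[_ tM]; have [] := dh t tM.
  - by rewrite in_itv /= lM andbT; lra.
  - move=> t; rewrite in_itv /= => /andP[_ tM]; rewrite -lee_fin.
    exact: le_trans (kpart_ge nu0 tM) h.
have := @derive_val _ _ _ _ _ _ _ e0; rewrite (@derive_val _ _ _ _ _ _ _ (dh l lM)) => e.
have e1 : nu * dK l = 1 by lra.
by rewrite -[LHS](mulfK (lt0r_neq0 d0)) e1 mul1r.
Qed.

(* Weak duality with equality: (u, a) is the contribution of a maximizer of the
   dual problem on the mu side, l the one on the kappa side. *)
Lemma gam_min N alpha u a l : l < M -> a + K l = 0 ->
  (forall nu, 0 < nu -> ((u - nu * a)%:E <= nu%:E * legendre N (alpha / nu))%E) ->
  ((dK l)^-1%:E * legendre N (alpha / (dK l)^-1) <= (u - (dK l)^-1 * a)%:E)%E ->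
  gam N alpha (dK l)^-1 = (u + l)%:E /\
  forall nu, 0 < nu -> ((u + l)%:E <= gam N alpha nu)%E /\
    ((gam N alpha nu <= (u + l)%:E)%E -> nu = (dK l)^-1).
Proof.
move=> lM aK ge le; have d0 : 0 < (dK l)^-1 by rewrite invr_gt0; exact: dLk_gt0.
have split_sum nu : (u + l)%:E = ((u - nu * a)%:E + (l - nu * K l)%:E)%E.
  have ae : a = - K l by lra.
  by rewrite -EFinD; congr EFin; rewrite ae; ring.
have lb nu : 0 < nu -> ((u + l)%:E <= gam N alpha nu)%E.
  by move=> nu0; rewrite (split_sum nu) leeD ?ge ?kpart_ge.
split.
  apply/eqP; rewrite eq_le lb // andbT (split_sum (dK l)^-1).
  by rewrite leeD ?kpart_tangent.
move=> nu nu0; split; first exact: lb.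
(* If the kappa part exceeded its lower bound, the sum would exceed u + l, because the N part is at
   least u - nu a. *)
move=> h; apply: kpart_tangent_unique => //; rewrite leNgt; apply/negP => lt.
move: h; apply/negP; rewrite -ltNge (split_sum nu).
by apply: lee_ltD => //; exact: ge.
Qed.

(** A sum of two suprema is a joint supremum. The N term can be moved across the inequality because
    it is finite: l' = 0 bounds it above and [l0] below. *)
Lemma gam_le N alpha nu u l0 a0 : 0 < nu -> (forall l, N l != -oo%E) ->
  N l0 = a0%:E ->
  (forall l a l', N l = a%:E -> l' < M -> l * alpha + l' - nu * (a + K l') <= u) ->
  (gam N alpha nu <= u%:E)%E.
Proof.
move=> nu0 NN N0 h; rewrite /gam.
have le1 l' : l' < M -> (nu%:E * legendre N (alpha / nu) <= (u - (l' - nu * K l'))%:E)%E.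
  move=> l'M; apply: perspective_le => // l a Nl.
  by have := h _ _ _ Nl l'M; lra.
have := perspective_ge alpha nu0 N0; have := le1 0 (lmax_gt0 kappaP).
case: (nu%:E * legendre N (alpha / nu))%E le1 => [p| |] //= le1 _ _.
have : (kpart nu <= (u - p)%:E)%E.
  apply: kpart_le => // l' /le1; rewrite lee_fin; lra.
by rewrite EFinB leeBrDl.
Qed.

(* gam is a supremum of affine functions of nu, each bounded by V at nu0. *)
Lemma gam_nonincreasing N alpha nu0 nu1 nu2 V l0 a0 :
  (forall l, N l != -oo%E) -> N l0 = a0%:E ->
  0 < nu1 -> nu1 <= nu2 -> nu2 <= nu0 ->
  gam N alpha nu0 = V%:E -> (V%:E <= gam N alpha nu1)%E ->
  (gam N alpha nu2 <= gam N alpha nu1)%E.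
Proof.
move=> NN N0 nu10 nu12 nu20 gV; case g1 : (gam N alpha nu1) => [G| |] //; last first.
  by move=> _; exact: leey.
rewrite lee_fin => VG; apply: (gam_le (lt_le_trans nu10 nu12) NN N0) => l a l' Nl l'M.
have ge nu : 0 < nu -> ((l * alpha + l' - nu * (a + K l'))%:E <= gam N alpha nu)%E.
  move=> nup; have -> : l * alpha + l' - nu * (a + K l') =
    (l * alpha - nu * a) + (l' - nu * K l') by ring.
  by rewrite EFinD leeD ?kpart_ge // perspective_ge.
have := ge _ nu10; rewrite g1 lee_fin => h1.
have := ge nu0 (lt_le_trans nu10 (le_trans nu12 nu20)); rewrite gV lee_fin => h0.
(* A term nonincreasing in nu is bounded by its value at nu1; a nondecreasing one by its value at
   nu0, hence by V <= G. *)
have [c0|/ltW c0] := leP 0 (a + K l').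
  by have := ler_wpM2r c0 nu12; lra.
by have := ler_wnM2r c0 nu20; lra.
Qed.

Lemma gam_lim0 N alpha nu0 V l0 a0 :
  (forall l, N l != -oo%E) -> N l0 = a0%:E -> 0 < nu0 ->
  gam N alpha nu0 = V%:E ->
  (forall nu, 0 < nu -> (V%:E <= gam N alpha nu)%E /\
    ((gam N alpha nu <= V%:E)%E -> nu = nu0)) ->
  (V%:E < lim (gam N alpha nu @[nu --> 0^'+]))%E.
Proof.
move=> NN N0 nu00 gV gmin.
have mono x y : 0 < x -> x <= y -> y <= nu0 ->
    (gam N alpha y <= gam N alpha x)%E.
  move=> x0 xy y1.
  by apply: (gam_nonincreasing NN N0 _ xy y1 gV) => //; exact: (gmin _ _).1.
have cv : cvg (gam N alpha nu @[nu --> 0^'+]).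
  apply/cvg_ex; eexists.
  apply: (@nonincreasing_at_right_cvge _ (gam N alpha) 0 (BRight nu0)) => //.
  move=> x y; rewrite !in_itv /= => /andP[x0 _] /andP[_ y1] xy.
  exact: mono.
(* Any point of (0, nu0) would do: there [gam] exceeds V by uniqueness, and monotonicity carries
   this bound to the limit. *)
have h0 : 0 < nu0 / 2 by lra.
have lt : (V%:E < gam N alpha (nu0 / 2))%E.
  rewrite ltNge; apply/negP => /(gmin _ h0).2; lra.
apply: (lt_le_trans lt); apply: lime_ge cv _; near=> nu.
have nup : 0 < nu by [].
have nule : nu <= nu0 / 2 by near: nu; exact: nbhs_right_le.
by apply: mono => //; lra.
Unshelve. all: by end_near. Qed.

End Duality.

(** * Existence and optimality of a dual maximizer, with [m] standing for l |-> [mgf mu (s * l)] *)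

Section DualProblem.
Context {R : realType} (kappa : R).
Hypothesis kappaP : 8 / 3 < kappa < 8.
Variable m : R -> \bar R.
Hypothesis m0 : m 0 = 1%E.
Hypothesis m_gt0 : forall l, (0 < m l)%E.
Hypothesis m_lsc : forall l c, (c%:E < m l)%E -> \forall h \near l, (c%:E < m h)%E.
Implicit Types (nu l a u V alpha : R).

Local Notation M := (lmax kappa).
Local Notation K := (Lk kappa).
Local Notation dK := (dLk kappa).

(* The constraint Lambda_mu(l) + Lambda_kappa(l') <= 0 with logarithms cleared,
   so that it makes sense, and is closed, up to the boundary l' = M, where
   cosq vanishes and the constraint therefore fails. *)
Definition feasible : set (R * R) :=
  [set q | ((amp kappa)%:E * m q.1 <= (cosq (phase kappa q.2))%:E)%E].

(** The complement is open: a real c strictly between [cosq] / [amp] and m(l) splits the violated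
    constraint into one open condition on each coordinate. *)
Lemma closed_feasible : closed feasible.
Proof.
have a0 := amp_gt0 kappaP.
move=> [l l'] cl; rewrite /feasible /= leNgt; apply/negP => lt.
have [c c1 c2] : exists2 c : R, cosq (phase kappa l') < amp kappa * c & (c%:E < m l)%E.
  move: lt; case: (m l) (m_gt0 l) => [r| |] // _.
    rewrite -EFinM lte_fin => lt.
    exists ((cosq (phase kappa l') / amp kappa + r) / 2).
      rewrite -ltr_pdivrMl // mulrC midf_lt // ltr_pdivrMr //.
      by rewrite mulrC.
    by rewrite lte_fin midf_lt // ltr_pdivrMr // mulrC.
  move=> _; exists ((cosq (phase kappa l') + 1) / amp kappa); last exact: ltry.
  by rewrite mulrC divfK ?gt_eqF // ltrDl.
have n1 : \forall h \near l, (c%:E < m h)%E by exact: m_lsc.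
have n2 : \forall h \near l', cosq (phase kappa h) < amp kappa * c.
  by apply: (cvgr_lt _ (@continuous_cosq_phase _ kappa l')).
have nb : nbhs (l, l') ([set h | (c%:E < m h)%E] `*`
    [set h | cosq (phase kappa h) < amp kappa * c]).
  exists ([set h | (c%:E < m h)%E], [set h | cosq (phase kappa h) < amp kappa * c]) => //.
have [[h h'] [/= Fh [/= H1 H2]]] := cl _ nb.
move: Fh; rewrite /feasible /= leNgt => /negP; apply.
apply: (@lt_trans _ _ (amp kappa * c)%:E); first by rewrite lte_fin.
by rewrite EFinM lte_pmul2l // lte_fin.
Qed.

Lemma feasibleE l l' b : m l = (expR b)%:E -> l' < M ->
  feasible (l, l') <-> b + K l' <= 0.
Proof.
move=> ml l'M; rewrite /feasible /= ml -EFinM lee_fin -(expR_Lk kappaP l'M).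
rewrite mulrAC ger_pMl; last by rewrite cosq_gt0 // phase_lt.
by rewrite -expRD -[1]expR0 ler_expR addrC.
Qed.

Lemma expR_of_finite l : (m l < +oo)%E -> exists b, m l = (expR b)%:E.
Proof.
case: (m l) (m_gt0 l) => [r| |] //; rewrite lte_fin => r0 _.
by exists (ln r); rewrite lnK.
Qed.

Lemma feasible_bounded alpha p d : 0 < alpha -> 0 < p -> 0 < d ->
  (forall l, 0 <= l -> ((p * expR (d * l))%:E <= m l)%E) ->
  exists B, forall l l', feasible (l, l') -> l' <= M -> 0 <= l * alpha + l' ->
    `|l| <= B /\ `|l'| <= B.
Proof.
move=> al0 p0 d0 growth; have a0 := amp_gt0 kappaP; have M0 := lmax_gt0 kappaP.
pose beta := 8 * pi ^+ 2 / kappa.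
have k0 : 0 < kappa by case/andP: kappaP; lra.
have b0 : 0 < beta by rewrite divr_gt0 // mulr_gt0 // exprn_gt0 // pi_gt0.
(* This rate gives e beta alpha = d / 2, so the upper bound absorbs only half of the exponent d
   l. *)
pose e := d / (2 * (beta * alpha)).
have ba0 : 0 < beta * alpha by rewrite mulr_gt0.
have e0 : 0 < e by rewrite divr_gt0 // mulr_gt0.
pose C := e * (`|phase kappa 0| + beta * M) + 1 / (4 * e).
pose H := Num.max 0 (2 * (C - ln (p * amp kappa)) / d).
have H0 : 0 <= H by rewrite le_max lexx.
have upper l l' : feasible (l, l') -> l' <= M -> 0 <= l * alpha + l' -> l <= H.
  move=> F l'M pos; have [l0|/ltW l0] := leP 0 l; last exact: le_trans H0.
  rewrite le_max; apply/orP; right; rewrite ler_pdivlMr //.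
  (* Here - l alpha <= l' <= M and l >= 0, so |l'| <= l alpha + M, and [phase] is affine of slope
     beta. *)
  have ph : `|phase kappa l'| <= `|phase kappa 0| + beta * (l * alpha + M).
    rewrite (phaseB kappaP 0 l') subr0; apply: le_trans (ler_normD _ _) _.
    rewrite lerD2l normrM gtr0_norm // ler_pM2l //.
    have la : 0 <= l * alpha by rewrite mulr_ge0 // ltW.
    by rewrite ler_norml; apply/andP; split; lra.
  have h1 : amp kappa * (p * expR (d * l)) <= expR (e * `|phase kappa l'| + 1 / (4 * e)).
    rewrite -lee_fin; apply: le_trans (_ : (cosq (phase kappa l'))%:E <= _)%E; last first.
      by rewrite lee_fin cosq_le_expR.
    by apply: le_trans F; rewrite EFinM lee_pmul2l // growth.
  have h2 : ln (p * amp kappa) + d * l <= e * `|phase kappa l'| + 1 / (4 * e).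
    rewrite -ler_expR expRD lnK ?posrE ?mulr_gt0 //.
    by rewrite [p * _]mulrC -mulrA.
  have h3 : e * `|phase kappa l'| <= e * (`|phase kappa 0| + beta * M) + d * l / 2.
    apply: le_trans (ler_wpM2l (ltW e0) ph) _.
    have -> : e * (`|phase kappa 0| + beta * (l * alpha + M)) =
      e * (`|phase kappa 0| + beta * M) + (e * (beta * alpha)) * l by ring.
    have -> : e * (beta * alpha) = d / 2 by rewrite /e; field; rewrite !gt_eqF.
    lra.
  rewrite /C; lra.
(* H bounds l above; l' <= M then forces l >= - M / alpha, and l <= H forces l' >= - H alpha. *)
exists (H + M / alpha + (M + H * alpha)) => l l' F l'M pos.
have lH := upper _ _ F l'M pos.
have lM : - (M / alpha) <= l.
  by rewrite -mulNr ler_pdivrMr //; lra.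
have lHa : l * alpha <= H * alpha by rewrite ler_pM2r.
have B2 : 0 < M / alpha by rewrite divr_gt0.
have B4 : 0 <= H * alpha by rewrite mulr_ge0 // ltW.
by split; rewrite ler_norml; apply/andP; split; lra.
Qed.

Lemma Lk_right_room l c : l < M -> K l < c ->
  exists t, [/\ 0 < t, l + t < M & K (l + t) <= c].
Proof.
move=> lM Kc; have dd := dLk_gt0 kappaP lM.
have e0 : 0 < c - K l by rewrite subr_gt0.
have near1 := is_derive_upper_bound 1 (is_derive_Lk kappaP lM) e0.
pose D := dK l + (c - K l); have D0 : 0 < D by rewrite addr_gt0.
near (0 : R)^'+ => t; exists t.
have t0 : 0 < t by [].
have tM : t < M - l by near: t; apply: nbhs_right_lt; rewrite subr_gt0.
have tD : t < (c - K l) / D by near: t; apply: nbhs_right_lt; rewrite divr_gt0.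
have : K (l + t * 1) <= K l + t * (1 * dK l + (c - K l)) by near: t.
rewrite mulr1 mul1r -/D => Kt.
move: tD; rewrite (ltr_pdivlMr _ _ D0) => tD'.
split; first exact: t0.
  by rewrite -ltrBrDl.
apply: (le_trans Kt); rewrite -lerBrDl; exact: ltW.
Unshelve. all: by end_near. Qed.

(** Compactness gives a maximizer. The constraint is active there, since with slack left l' could be
    raised, and the objective with it. *)
Lemma dual_max alpha p d : 0 < alpha -> 0 < p -> 0 < d ->
  (forall l, 0 <= l -> ((p * expR (d * l))%:E <= m l)%E) ->
  exists l a l', [/\ m l = (expR a)%:E, l' < M, a + K l' = 0 &
    forall h b h', m h = (expR b)%:E -> h' < M -> b + K h' <= 0 ->
      h * alpha + h' <= l * alpha + l'].
Proof.
move=> al0 p0 d0 growth; have M0 := lmax_gt0 kappaP.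
have [B bB] := feasible_bounded al0 p0 d0 growth.
have m0e : m 0 = (expR 0)%:E by rewrite m0 expR0.
have F0 : feasible (0, 0) by apply/(feasibleE m0e M0); rewrite Lk0 // addr0.
have [|B0 _] := bB 0 0 F0 (ltW M0); first by rewrite mul0r addr0.
rewrite normr0 in B0.
pose A := (`[- B, B]%classic `*` `[- B, M]%classic) `&` feasible.
have cA : compact A.
  apply: compact_closedI closed_feasible.
  by apply: compact_setX; exact: segment_compact.
have A0 : A (0, 0).
  by split => //; split; rewrite /= in_itv /= oppr_le0 B0 //= ltW.
have cf : {within A, continuous (fun q : R * R => q.1 * alpha + q.2)}.
  apply: continuous_subspaceT => q; apply: cvgD; last exact: cvg_snd.
  by apply: cvgM; [exact: cvg_fst|exact: cvg_cst].
have [[l l']] := compact_EVT_max (ex_intro _ _ A0) cA cf.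
rewrite inE => -[[_ /= +] F] max; rewrite in_itv /= => /andP[_ l'M].
have lpos : 0 <= l * alpha + l'.
  by have := max (0, 0) (mem_set A0); rewrite /= mul0r addr0.
(* Feasible points outside the box have negative objective, below the value 0 at the feasible
   origin. *)
have opt h h' : feasible (h, h') -> h' <= M -> h * alpha + h' <= l * alpha + l'.
  move=> Fh h'M; have [pos|/ltW neg] := leP 0 (h * alpha + h'); last exact: le_trans lpos.
  have [] := bB _ _ Fh h'M pos; rewrite !ler_norml => hB h'B.
  apply: (max (h, h')); rewrite inE; split => //; split; rewrite /= in_itv //=.
  by move: h'B => /andP[-> _].
have l'ltM : l' < M.
  rewrite lt_neqAle l'M andbT; apply/eqP => e; move: F.
  rewrite /feasible /= e cosq_phase_lmax // leNgt => /negP; apply.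
  by rewrite mule_gt0 // lte_fin amp_gt0.
have mfin : (m l < +oo)%E.
  rewrite ltNge leye_eq; apply/eqP => e; move: F.
  by rewrite /feasible /= e gt0_muley // lte_fin amp_gt0.
have [a ml] := expR_of_finite mfin.
have le0 : a + K l' <= 0 by apply/(feasibleE ml l'ltM).
exists l, a, l'; split => //; last first.
  by move=> h b h' mh h'M bK; apply: opt; [apply/(feasibleE mh)|exact: ltW].
apply/eqP; rewrite eq_le le0 /= leNgt; apply/negP => lt0.
have [t [t0 tM Kt]] : exists t, [/\ 0 < t, l' + t < M & K (l' + t) <= - a].
  by apply: Lk_right_room => //; rewrite -subr_gt0 -opprD oppr_gt0.
have Ft : feasible (l, l' + t) by apply/(feasibleE ml tM); rewrite -lerBrDl sub0r.
by have := opt _ _ Ft (ltW tM); rewrite lerD2l gerDl leNgt t0.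
Qed.

(* Moving from the maximizer towards h by t and from l' by t w, the constraint
   stays satisfied for small t as soon as w dK(l') < a - b. *)
Lemma dual_max_subgradient alpha l a l' :
  (forall l0 l1 a b t, 0 <= t <= 1 -> m l0 = (expR a)%:E -> m l1 = (expR b)%:E ->
    (m (l0 + t * (l1 - l0)) <= (expR (a + t * (b - a)))%:E)%E) ->
  m l = (expR a)%:E -> l' < M -> a + K l' = 0 ->
  (forall h b h', m h = (expR b)%:E -> h' < M -> b + K h' <= 0 ->
      h * alpha + h' <= l * alpha + l') ->
  forall h b, m h = (expR b)%:E -> h * alpha - (dK l')^-1 * b <= l * alpha - (dK l')^-1 * a.
Proof.
move=> conv ml l'M aK opt h b mh; rewrite leNgt; apply/negP => lt.
have d0 := dLk_gt0 kappaP l'M.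
(* The move by (t (h - l), t w) changes the objective by t (w - x) and, to first order, the
   constraint by at most t dK(l') (w - y). The negated claim is x < y, which leaves room for w. *)
pose x := - ((h - l) * alpha); pose y := - ((dK l')^-1 * (b - a)).
have xy : x < y by rewrite /x /y; lra.
pose w := (x + y) / 2.
have wlt : w * dK l' + (b - a) < 0.
  have wy : w < y by rewrite /w; lra.
  have : w * dK l' < y * dK l' by rewrite ltr_pM2r.
  have -> : y * dK l' = - (b - a) by rewrite /y; field; rewrite gt_eqF.
  lra.
(* With this slack the bound on K becomes K(l') - t (b - a), which cancels the convexity bound a + t
   (b - a). *)
have e0 : 0 < - (w * dK l' + (b - a)) by lra.
have nr := is_derive_upper_bound w (is_derive_Lk kappaP l'M) e0.
have w1 : 0 < `|w| + 1 by rewrite ltr_wpDl.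
near (0 : R)^'+ => t.
have t0 : 0 < t by [].
have t1 : t < 1 by near: t; exact: nbhs_right_lt.
have tM : t < (M - l') / (`|w| + 1).
  by near: t; apply: nbhs_right_lt; rewrite divr_gt0 ?subr_gt0.
have Kt : K (l' + t * w) <= K l' + t * (w * dK l' + - (w * dK l' + (b - a))) by near: t.
have twM : l' + t * w < M.
  rewrite ltr_pdivlMr // in tM.
  have := ler_wpM2l (ltW t0) (ler_norm w); lra.
have t01 : 0 <= t <= 1 by rewrite !ltW.
have le := conv _ _ _ _ _ t01 ml mh.
have [c mc] : exists c, m (l + t * (h - l)) = (expR c)%:E.
  by apply: expR_of_finite; apply: le_lt_trans le _; exact: ltry.
have cb : c <= a + t * (b - a) by rewrite -ler_expR -lee_fin -mc.
have := opt _ _ _ mc twM; have -> : c + K (l' + t * w) <= 0 = true by lra.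
move=> /(_ isT).
have -> : (l + t * (h - l)) * alpha + (l' + t * w) = l * alpha + l' + t * (w - x).
  by rewrite /x; ring.
have : 0 < t * (w - x) by rewrite mulr_gt0 // /w; lra.
lra.
Unshelve. all: by end_near. Qed.

End DualProblem.

(** * Minimizers of gamma for each sign of alpha *)

Section Minimizers.
Context {R : realType} (kappa : R) (mu : probability R R).
Hypothesis kappaP : 8 / 3 < kappa < 8.
Implicit Types (l a s nu alpha : R).

Local Notation N := (Lambda_mu mu).

Lemma Lambda_mu_neqNy l : N l != -oo%E.
Proof.
rewrite /Lambda_mu -/(mgf mu l).
by case: (mgf mu l) (mgf_gt0 mu l).
Qed.

Lemma Lambda_muE l a : N l = a%:E <-> mgf mu l = (expR a)%:E.
Proof.
rewrite /Lambda_mu -/(mgf mu l); split; last by move=> -> /=; rewrite expRK.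
case: (mgf mu l) (mgf_gt0 mu l) => [r| |] //; rewrite lte_fin => r0 [<-].
by rewrite lnK.
Qed.

Lemma Lambda_mu0 : N 0 = 0%E.
Proof. by apply/Lambda_muE; rewrite mgf0 expR0. Qed.

Lemma Lambda_mu_le0 s l : mu [set x | (0 < s * x)%R] = 0%E -> 0 <= l ->
  (N (s * l) <= 0)%E.
Proof.
move=> n0 l0; have := mgf_le1 n0 l0; rewrite /Lambda_mu -/(mgf mu (s * l)).
by case: (mgf mu (s * l)) => [r| |] //=; rewrite !lee_fin; exact: ln_le0.
Qed.

Lemma gam_reflect (L : R -> \bar R) s alpha : s * s = 1 ->
  gam kappa L alpha = gam kappa (fun l => L (s * l)) (s * alpha).
Proof.
move=> s2; apply/funext => nu; congr (_ * _ + _)%E.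
by rewrite (legendre_reflect _ _ s2) mulrA.
Qed.

(** Reflection by s makes s alpha positive. The subgradient inequality at the dual maximizer is the
    upper bound that [gam_min] requires of the N term. *)
Lemma gam_minimizer s alpha : s * s = 1 -> 0 < s * alpha ->
  (0 < mu [set x | (0 < s * x)%R])%E ->
  exists nu0 V : R, [/\ 0 < nu0, gam kappa N alpha nu0 = V%:E,
    (V%:E < lim (gam kappa N alpha nu @[nu --> 0^'+]))%E &
    forall nu, 0 < nu -> (V%:E <= gam kappa N alpha nu)%E /\
      ((gam kappa N alpha nu <= V%:E)%E -> nu = nu0)].
Proof.
move=> s2 sa /mgf_growth[p [d [p0 d0 growth]]].
rewrite (gam_reflect N alpha s2).
pose m l := mgf mu (s * l).
have m0 : m 0 = 1%E by rewrite /m mulr0 mgf0.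
have m_gt0 l : (0 < m l)%E by exact: mgf_gt0.
have m_lsc l c : (c%:E < m l)%E -> \forall h \near l, (c%:E < m h)%E.
  move=> /mgf_lower_semicontinuous; apply: (@mulrl_continuous R s l).
have m_conv (l0 l1 a b t : R) : 0 <= t <= 1 -> m l0 = (expR a)%:E -> m l1 = (expR b)%:E ->
    (m (l0 + t * (l1 - l0))%R <= (expR (a + t * (b - a)))%:E)%E.
  move=> t01 e0 e1; have := mgf_log_convex t01 e0 e1.
  by rewrite /m; congr (mgf _ _ <= _)%E; ring.
have [l [a [l' [ml l'M aK opt]]]] := dual_max kappaP m0 m_gt0 m_lsc sa p0 d0 growth.
have sub := dual_max_subgradient kappaP m_gt0 m_conv ml l'M aK opt.
have NE h b : N (s * h) = b%:E <-> m h = (expR b)%:E by exact: Lambda_muE.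
have NN h : N (s * h) != -oo%E by exact: Lambda_mu_neqNy.
have Nl : (fun l => N (s * l)) l = a%:E by apply/NE.
have nu00 : 0 < (dLk kappa l')^-1 by rewrite invr_gt0 dLk_gt0.
have [] := @gam_min _ _ kappaP (fun l => N (s * l)) (s * alpha) (l * (s * alpha)) a l' l'M aK.
- by move=> nu nu0; exact: (perspective_ge (N := fun l => N (s * l)) _ nu0 Nl).
- by apply: perspective_le => // h b /NE; exact: sub.
move=> gV gmin; exists (dLk kappa l')^-1, (l * (s * alpha) + l'); split => //.
exact: (gam_lim0 kappaP NN Nl nu00 gV gmin).
Qed.

Lemma gam_pinfty s alpha nu : s * s = 1 -> 0 < s * alpha ->
  mu [set x | (0 < s * x)%R] = 0%E -> 0 < nu -> gam kappa N alpha nu = +oo%E.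
Proof.
move=> s2 sa n0 nu0; rewrite (gam_reflect N alpha s2) /gam.
suff -> : legendre (fun l => N (s * l)) (s * alpha / nu) = +oo%E.
  rewrite gt0_muley ?lte_fin // addye //.
  have := kpart_ge nu0 (lmax_gt0 kappaP).
  by case: (kpart _ _).
apply/eqP; rewrite eq_le leey /= leNgt; apply/negP => lt.
have x0 : 0 < s * alpha / nu by rewrite divr_gt0.
(* N(s l) <= 0 for l >= 0, so the transform at a positive point dominates an unbounded linear
   function of l. *)
have ge l : 0 <= l -> ((l * (s * alpha / nu))%:E <= legendre (fun l => N (s * l)) (s * alpha / nu))%E.
  move=> l0; apply: le_trans (_ : _ <= (l * (s * alpha / nu))%:E - N (s * l))%E _; last first.
    by apply: ereal_sup_ubound; exists l.
  have := Lambda_mu_le0 n0 l0.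
  case: (N (s * l)) (Lambda_mu_neqNy (s * l)) => [a| |] // _.
  by rewrite -EFinB !lee_fin; lra.
move: lt ge; case: (legendre _ _) => [r| |] // _ ge.
  have := ge ((`|r| + 1) / (s * alpha / nu)) (divr_ge0 (addr_ge0 (normr_ge0 r) ler01) (ltW x0)).
  by rewrite divfK ?gt_eqF // lee_fin; have := ler_norm r; lra.
by have := ge 0 (lexx 0).
Qed.

(* If Lambda_mu^*(0) is finite, the minimum is the l with Lk l = Lambda_mu^*(0). *)
Lemma gam0_minimizer :
  (forall nu, 0 < nu -> gam kappa N 0 nu = +oo%E) \/
  exists nu0 V : R, [/\ 0 < nu0, V < lmax kappa, gam kappa N 0 nu0 = V%:E &
    forall nu, 0 < nu -> (V%:E <= gam kappa N 0 nu)%E /\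
      ((gam kappa N 0 nu <= V%:E)%E -> nu = nu0)].
Proof.
have c0 : (0 <= legendre N 0)%E.
  apply: ereal_sup_ubound; exists 0 => //.
  by rewrite mul0r Lambda_mu0 sube0.
case cE : (legendre N 0) c0 => [c| |] // c0.
  rewrite lee_fin in c0.
  have [l lM lc] := Lk_surj kappaP c0.
  (* At alpha = 0 the N term is nu c for every nu, of the form u - nu a with u = 0 and a = - c. *)
  have [] := @gam_min _ _ kappaP N 0 0 (- c) l lM.
  - by rewrite lc addNr.
  - by move=> nu nu0; rewrite mul0r cE sub0r mulrN opprK.
  - by rewrite mul0r cE sub0r mulrN opprK.
  rewrite add0r => gV gmin; right; exists (dLk kappa l)^-1, l; split => //.
  by rewrite invr_gt0; exact: dLk_gt0.
left => nu nu0; rewrite /gam mul0r cE gt0_muley ?lte_fin // addye //.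
have := kpart_ge nu0 (lmax_gt0 kappaP).
by case: (kpart _ _).
Qed.

Lemma gamma_k_gt0 alpha nu : 0 < nu -> gamma_k kappa mu alpha nu = gam kappa N alpha nu.
Proof. by rewrite /gamma_k => ->. Qed.

Lemma gamma_k_at0 alpha : alpha != 0 ->
  gamma_k kappa mu alpha 0 = lim (gam kappa N alpha nu @[nu --> 0^'+]).
Proof. by rewrite /gamma_k ltxx eqxx => /negbTE ->. Qed.

Lemma gamma_k_00 : gamma_k kappa mu 0 0 = (lmax kappa)%:E.
Proof. by rewrite /gamma_k ltxx !eqxx. Qed.

Lemma unique_minimizer_gt0 (f : R -> \bar R) nu0 (V : R) : 0 < nu0 ->
  f nu0 = V%:E -> (V%:E < f 0%R)%E ->
  (forall nu, 0 < nu -> (V%:E <= f nu)%E /\ ((f nu <= V%:E)%E -> nu = nu0)) ->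
  minimizer_nonneg f nu0 /\ forall nu1, minimizer_nonneg f nu1 -> nu1 = nu0.
Proof.
move=> nu00 fV f0 fmin; split.
  split; first exact: ltW.
  move=> y; rewrite le_eqVlt fV => /predU1P[<-|/fmin[]//]; exact: ltW.
move=> nu1 [nu10 /(_ nu0 (ltW nu00))]; rewrite fV.
move: nu10; rewrite le_eqVlt => /predU1P[<-|/fmin[]//].
by rewrite leNgt f0.
Qed.

End Minimizers.

Unset Implicit Arguments.

Theorem theorem5p2 (R : realType) (kappa alpha : R) (mu : probability R R) :
  8 / 3 < kappa < 8 ->
  [/\ (alpha = 0 ->
        exists nu0, minimizer_nonneg (gamma_k kappa mu alpha) nu0 /\
          forall nu1, minimizer_nonneg (gamma_k kappa mu alpha) nu1 -> nu1 = nu0),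
      ((0 < alpha /\ (0 < mu [set` `]0%R, +oo[])%E) \/ (alpha < 0 /\ (0 < mu [set` `]-oo, 0%R[])%E)) ->
        exists nu0, minimizer_nonneg (gamma_k kappa mu alpha) nu0 /\
          (forall nu1, minimizer_nonneg (gamma_k kappa mu alpha) nu1 -> nu1 = nu0) /\
          0 < nu0
    & ((0 < alpha /\ mu [set` `]0%R, +oo[] = 0%E) \/ (alpha < 0 /\ mu [set` `]-oo, 0%R[] = 0%E)) ->
        forall nu, 0 <= nu -> gamma_k kappa mu alpha nu = +oo%E].
Proof.
move=> kappaP.
have pos_half : [set` `]0%R, +oo[] = [set x : R | (0 < 1 * x)%R].
  by apply/seteqP; split => x /=; rewrite in_itv /= andbT mul1r.
have neg_half : [set` `]-oo, 0%R[] = [set x : R | (0 < (-1) * x)%R].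
  by apply/seteqP; split => x /=; rewrite in_itv /= mulN1r oppr_gt0.
split.
- move=> ->; have [inf|[nu0 [V [nu0p VM gV gmin]]]] := gam0_minimizer mu kappaP.
    (* Gamma is infinite on (0, oo) but finite at 0, so 0 is the only minimizer. *)
    exists 0; split.
      split => // y; rewrite le_eqVlt gamma_k_00 => /predU1P[<-|y0].
        by rewrite gamma_k_00.
      by rewrite gamma_k_gt0 // inf // leey.
    move=> nu1 [nu10 /(_ 0 (lexx 0))]; rewrite gamma_k_00.
    move: nu10; rewrite le_eqVlt => /predU1P[<- //|nu10].
    by rewrite gamma_k_gt0 // inf.
  (* Here V < [lmax] = gamma(0, 0) excludes 0. *)
  exists nu0; apply: (@unique_minimizer_gt0 _ _ nu0 V) => //.
  + by rewrite gamma_k_gt0.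
  + by rewrite gamma_k_00 lte_fin.
  + by move=> nu nup; rewrite gamma_k_gt0 //; exact: gmin.
- move=> hyp.
  have [a0 [nu0 [V [nu00 gV V0 gmin]]]] : alpha != 0 /\ exists nu0 V : R,
      [/\ 0 < nu0, gam kappa (Lambda_mu mu) alpha nu0 = V%:E,
       (V%:E < lim (gam kappa (Lambda_mu mu) alpha nu @[nu --> 0^'+]))%E &
      forall nu, 0 < nu -> (V%:E <= gam kappa (Lambda_mu mu) alpha nu)%E /\
        ((gam kappa (Lambda_mu mu) alpha nu <= V%:E)%E -> nu = nu0)].
    case: hyp => -[a0 mup].
      split; first by rewrite gt_eqF.
      rewrite pos_half in mup.
      by apply: (@gam_minimizer _ _ _ kappaP 1 alpha) => //; rewrite mul1r.
    split; first by rewrite lt_eqF.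
    rewrite neg_half in mup.
    by apply: (@gam_minimizer _ _ _ kappaP (-1) alpha) => //; rewrite mulN1r ?opprK ?oppr_gt0.
  exists nu0.
  have [] := @unique_minimizer_gt0 _ (gamma_k kappa mu alpha) nu0 V nu00.
  + by rewrite gamma_k_gt0.
  + by rewrite gamma_k_at0.
  + by move=> nu nup; rewrite gamma_k_gt0 //; exact: gmin.
  by [].
- move=> hyp.
  have [a0 inf] : alpha != 0 /\
      forall nu, 0 < nu -> gam kappa (Lambda_mu mu) alpha nu = +oo%E.
    case: hyp => -[a0 mu0].
      split => [|nu nu0]; first by rewrite gt_eqF.
      rewrite pos_half in mu0.
      by apply: (@gam_pinfty _ _ _ kappaP 1 alpha) => //; rewrite mul1r.
    split => [|nu nu0]; first by rewrite lt_eqF.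
    rewrite neg_half in mu0.
    by apply: (@gam_pinfty _ _ _ kappaP (-1) alpha) => //; rewrite mulN1r ?opprK ?oppr_gt0.
  move=> nu; rewrite le_eqVlt => /predU1P[<-|nu0]; last by rewrite gamma_k_gt0 // inf.
  rewrite gamma_k_at0 //; apply: lim_near_cst => //.
  by near=> nu'; exact: inf.
Unshelve. all: by end_near. Qed.
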